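(* Let $x>0$, $T>0$ and $n\in\mathbb{N}$. Let $\{X_{s,t}\}_{s\le t}$ be a stochastic flow on $[0,+\infty)$ and let $\{Y_{k,l}\}_{k\le l}$ be a stochastic flow on $[0,+\infty)$ in discrete-time such that (almost surely) $$\lim_{y\to+\infty}X_{0,T}(y)=\lim_{y\to+\infty}Y_{0,n}(y)=+\infty$$ and $$\mathbf{P}(X_{0,T}(y)=x)=\mathbf{P}(Y_{0,n}(y)=x)=0\quad\text{for any }y>0.$$ Then for each differentiable function $f:[0,+\infty)\to\mathbb{R}$ with compact support and satisfying $f(0)=0$, $$\mathbf{E}[f(X^{*}_{0,T}(x))]-\mathbf{E}[f(Y^{*}_{0,n}(x))]=\int_{0}^{+\infty}f'(y)\left(\mathbf{P}(Y_{0,n}(y)>x)-\mathbf{P}(X_{0,T}(y)>x)\right)\mathrm{d}y .$$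
   Context: Let $\mathcal{T}$ be the set of all non-decreasing right-continuous functions $\varphi:[0,+\infty)\to[0,+\infty)$, with the convention $\varphi(0-)=0$; it is a Polish space under $\rho(\varphi,\psi)=\sum_{n\ge1}2^{-n}\min\{\rho_n(\varphi,\psi),1\}$, where for $K>0$, $\rho_K(\varphi,\psi)=\inf\{\varepsilon>0:\varphi(x-\varepsilon)-\varepsilon\le\psi(x)\le\varphi(x+\varepsilon)+\varepsilon\text{ for all }x\in[0,K]\}$ (functions in $\mathcal{T}$ are understood to be $0$ on $(-\infty,0)$). A stochastic flow on $[0,+\infty)$ is a family $\{X_{s,t}\}_{s\le t}$ ($s,t\in\mathbb{R}$) of $\mathcal{T}$-valued random variables such that: (i) $X_{s,u}=X_{t,u}\circ X_{s,t}$ and $X_{t,t}=\mathrm{id}$ a.s. for all $s\le t\le u$; (ii) for $t_0\le\dots\le t_n$ the variables $X_{t_{k-1},t_k}$, $k=1,\dots,n$, are independent; (iii) $X_{s,t}=X_{s+h,t+h}$ in law for $s\le t$, $h>0$; (iv) $X_{0,h}\to\mathrm{id}$ in probability as $h\downarrow0$. A stochastic flow on $[0,+\infty)$ in discrete-time is a family $\{Y_{k,l}\}_{k\le l}$ ($k,l\in\mathbb{Z}$) of $\mathcal{T}$-valued random variables such that: (i) $Y_{k,l}\circ Y_{j,k}=Y_{j,l}$ and $Y_{k,k}=\mathrm{id}$ a.s. for integers $j\le k\le l$; (ii) for integers $k_0\le\dots\le k_m$ the variables $Y_{k_{i-1},k_i}$, $i=1,\dots,m$, are independent; (iii) $Y_{k,l}=Y_{k+a,l+a}$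 in law for $k\le l$, $a\in\mathbb{N}$. Duals: $X^{*}_{s,t}(x):=\inf\{y\ge0:X_{-t,-s}(y)>x\}$ and $Y^{*}_{k,l}(x):=\inf\{y\ge0:Y_{-l,-k}(y)>x\}$.
   Formalization: The integrand f'(y)(P(Y_{0,n}(y)>x) − P(X_{0,T}(y)>x)) is additionally assumed Lebesgue integrable on [0,+∞), since for a merely differentiable f with compact support the right-hand integral need not exist. *)

(* Defs.v *)
From HB Require Import structures.
From mathcomp Require Import all_boot all_order all_algebra.
From mathcomp Require Import all_classical all_reals all_analysis.

Set Implicit Arguments.
Unset Strict Implicit.
Unset Printing Implicit Defensive.
Import Order.TTheory GRing.Theory Num.Theory.
Import numFieldNormedType.Exports.
Local Open Scope classical_set_scope.
Local Open Scope ring_scope.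

(* The space T of non-decreasing right-continuous functions
   [0, +oo[ -> [0, +oo[.  An element is represented by its extension by 0 to
   ]-oo, 0[, so that equality is equality of functions on [0, +oo[;
   non-negativity on [0, +oo[ follows from [ndrc_mono] and [ndrc_neg0]. *)
Record ndrc (R : realType) := Ndrc {
  ndrc_fun :> R -> R ;
  ndrc_mono : {homo ndrc_fun : y z / y <= z} ;
  ndrc_rcont : forall y : R, ndrc_fun z @[z --> y^'+] --> ndrc_fun y ;
  ndrc_neg0 : forall y : R, y < 0 -> ndrc_fun y = 0 }.

Section ndrc_identity.
Context {R : realType}.

Let idf (y : R) : R := Num.max y 0.

Let idf_mono : {homo idf : y z / y <= z}.
Proof. by move=> y z yz; rewrite /idf ge_max !le_max yz lexx /= orbT. Qed.

Let idf_rcont (y : R) : idf z @[z --> y^'+] --> idf y.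
Proof.
apply: cvg_at_right_filter.
have := @continuous_max _ _ (id : R -> R) (cst 0) y.
by apply; [exact: cvg_id | exact: cvg_cst].
Qed.

Let idf_neg0 (y : R) : y < 0 -> idf y = 0.
Proof. by move=> y0; apply/max_r/ltW. Qed.

Definition ndrc_id : ndrc R := Ndrc idf_mono idf_rcont idf_neg0.

End ndrc_identity.

HB.instance Definition _ (R : realType) := gen_eqMixin (ndrc R).
HB.instance Definition _ (R : realType) := gen_choiceMixin (ndrc R).
HB.instance Definition _ (R : realType) := isPointed.Build (ndrc R) ndrc_id.

Section ndrc_borel.
Context {R : realType}.
Implicit Types phi psi : ndrc R.

Definition rhoK (K : R) phi psi : R :=
  inf [set e : R | 0 < e /\ forall y, 0 <= y <= K ->
                   phi (y - e) - e <= psi y <= phi (y + e) + e].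

(* [rho] need not be symmetric, because [rhoK] is not near the end point [K],
   but [rho phi (psi n)] and [rho (psi n) phi] tend to 0 simultaneously. *)
Definition rho phi psi : R :=
  \big[+%R/0]_(1 <= n <oo) (2 ^- n * Num.min (rhoK n%:R phi psi) 1).

Definition rho_open : set (set (ndrc R)) :=
  [set A | forall phi, A phi ->
    exists2 r : R, 0 < r & forall psi, rho phi psi < r -> A psi].

End ndrc_borel.

(* [ndrc R] with its Borel sigma-algebra. *)
Definition ndrc_borel (R : realType) := g_sigma_algebraType (@rho_open R).

Section flows.
Context {d : measure_display} {Omega : measurableType d} {R : realType}.
Variable P : probability Omega R.

(* Mutual independence of finitely many random variables; since some of the
   [B i] may be the whole space, this contains the product rule for all
   subfamilies. *)
Definition mutually_independent (n : nat) (Z : 'I_n -> Omega -> ndrc_borel R) :=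
  forall B : 'I_n -> set (ndrc_borel R), (forall i, measurable (B i)) ->
    P (\bigcap_(i in [set: 'I_n]) (Z i @^-1` B i)) =
    (\prod_(i < n) P (Z i @^-1` B i))%E.

Definition same_law (Z Z' : Omega -> ndrc_borel R) :=
  forall B : set (ndrc_borel R), measurable B ->
    P (Z @^-1` B) = P (Z' @^-1` B).

Record stochastic_flow (X : R -> R -> Omega -> ndrc_borel R) : Prop := {
  flow_measurable : forall s t : R, s <= t -> measurable_fun setT (X s t) ;
  flow_comp : forall s t u : R, s <= t -> t <= u ->
    \forall w \ae P, forall y : R, 0 <= y -> X s u w y = X t u w (X s t w y) ;
  flow_id : forall t, \forall w \ae P, X t t w = ndrc_id ;
  flow_indep : forall (n : nat) (t : nat -> R),
    (forall k, (k < n)%N -> t k <= t k.+1) ->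
    mutually_independent (fun k : 'I_n => X (t k) (t k.+1)) ;
  flow_stationary : forall s t h : R, s <= t -> 0 < h ->
    same_law (X s t) (X (s + h) (t + h)) ;
  flow_continuous : forall e : R, 0 < e ->
    P [set w | e < rho (X 0 h w) ndrc_id] @[h --> 0^'+] --> 0%E }.

Record discrete_stochastic_flow (Y : int -> int -> Omega -> ndrc_borel R)
    : Prop := {
  dflow_measurable : forall k l : int, k <= l -> measurable_fun setT (Y k l) ;
  dflow_comp : forall j k l : int, j <= k -> k <= l ->
    \forall w \ae P, forall y : R, 0 <= y -> Y k l w (Y j k w y) = Y j l w y ;
  dflow_id : forall k, \forall w \ae P, Y k k w = ndrc_id ;
  dflow_indep : forall (m : nat) (k : nat -> int),
    (forall i, (i < m)%N -> k i <= k i.+1) ->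
    mutually_independent (fun i : 'I_m => Y (k i) (k i.+1)) ;
  dflow_stationary : forall (k l : int) (a : nat), k <= l ->
    same_law (Y k l) (Y (k + a%:Z) (l + a%:Z)) }.

(* Both duals, with time set [I] either [R] or [int].  The infimum is taken in
   the extended reals: it is +oo when [Z (- t) (- s) w] does not exceed [x]. *)
Definition dual (I : zmodType) (Z : I -> I -> Omega -> ndrc_borel R)
    (s t : I) (w : Omega) (x : R) : \bar R :=
  ereal_inf [set y%:E | y in [set y : R | 0 <= y /\ x < Z (- t) (- s) w y]].

End flows.

(* Differentiability on [0, +oo[, one-sided at 0; the values of [f] on
   ]-oo, 0[ play no role. *)
Definition differentiable_nneg (R : realType) (f : R -> R) :=
  (forall y : R, 0 < y -> derivable f y 1) /\
  cvg (h^-1 * (f h - f 0) @[h --> 0^'+]).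

Definition compact_support_nneg (R : realType) (f : R -> R) :=
  compact (closure [set y : R | 0 <= y /\ f y != 0]).

(* Main.v *)
Require Import Defs.
From HB Require Import structures.
From mathcomp Require Import all_boot all_order all_algebra.
From mathcomp Require Import all_classical all_reals all_analysis.
From mathcomp Require Import measurable_realfun.
From mathcomp Require Import ring lra.

(* Write tX and tY for the two dual variables at x.  By stationarity and absence
   of atoms, P(tX <= y) = P(X_{0,T}(y) > x) for y > 0, and likewise for Y, so the
   right-hand side is the integral of f' (F_Y - F_X) with F_X, F_Y the
   distribution functions of tX and tY.  The derivative f' need not be locally
   integrable, which rules out Fubini.  Instead
     Phi(y) = E[(f(y) - f(tY)) 1_{tY <= y}] - E[(f(y) - f(tX)) 1_{tX <= y}]
   is continuous, has right derivative f'(y) (F_Y(y) - F_X(y)) at every y > 0,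
   vanishes at 0 and equals E f(tX) - E f(tY) beyond the support of f.  The
   conclusion is the fundamental theorem of calculus for a continuous function
   whose right derivative exists everywhere and is integrable. *)

Set Implicit Arguments.
Unset Strict Implicit.
Unset Printing Implicit Defensive.
Import Order.TTheory GRing.Theory Num.Theory.
Import numFieldNormedType.Exports.
Local Open Scope classical_set_scope.
Local Open Scope ring_scope.

(** * Fundamental theorem of calculus for right derivatives *)

(** Continuous induction on the right end point: with an error [e] allowed, the supremum [s] of the
    points up to which the bound holds still satisfies it by left continuity of [F], and the local
    hypothesis at [s] rules out [s < b]. *)
Lemma increment_le_integral (R : realType) (F : R -> R) (v : R -> \bar R)
    (a b : R) :
  a < b -> {within `[a, b], continuous F} ->
  measurable_fun [set: R] v -> (forall x, 0 <= v x)%E ->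
  (forall x, x \in `]a, b[ -> \forall z \near x^'+,
    ((F z - F x)%:E <= \int[lebesgue_measure]_(t in `]x, z]) v t)%E) ->
  ((F b - F a)%:E <= \int[lebesgue_measure]_(t in `]a, b]) v t)%E.
Proof.
move=> ab /(continuous_within_itvP _ ab)[cF Fa Fb] mv v0 Fv.
set mu := lebesgue_measure.
have mvD D : measurable_fun D v by exact: measurable_funTS.
have intD x y z : x <= y -> y <= z -> (\int[mu]_(t in `]x, z]) v t =
    \int[mu]_(t in `]x, y]) v t + \int[mu]_(t in `]y, z]) v t)%E.
  move=> xy yz; rewrite (@itv_bndbnd_setU _ _ _ (BRight y))// ?bnd_simp//.
  rewrite ge0_integral_setU//; first exact: mvD.
  apply/disj_setPS => t [/=]; rewrite !in_itv/= => /andP[_ ty] /andP[].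
  by rewrite ltNge ty.
have int_ge0 D : (0 <= \int[mu]_(t in D) v t)%E by exact: integral_ge0.
have Fl x : a < x <= b -> F z @[z --> x^'-] --> F x.
  move=> /andP[ax]; rewrite le_eqVlt => /predU1P[->//|xb].
  by apply: cvg_at_left_filter; apply: cF; rewrite in_itv/= ax.
apply/lee_addgt0Pr => e e0.
(* The slack [e] starts the induction: the local hypothesis does not cover [a], where only right
   continuity of [F] is available. *)
pose ok z := ((F z - F a)%:E <= \int[mu]_(t in `]a, z]) v t + e%:E)%E.
pose A := [set c | a <= c <= b /\ forall z, a <= z <= c -> ok z].
have Aa : A a.
  split; first by rewrite lexx ltW.
  move=> z /andP[az za]; have -> : z = a by apply/le_anti/andP.
  by rewrite /ok subrr adde_ge0// lee_fin ltW.
have ubA : ubound A b by move=> c [/andP[]].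
have supA : has_sup A by split; [exists a | exists b].
set s := sup A.
have as_ : a <= s by apply: ub_le_sup => //; exists b.
have sb : s <= b by apply: ge_sup => //; exists a.
have okl z : a <= z < s -> ok z.
  move=> /andP[az zs].
  have sz0 : 0 < s - z by rewrite subr_gt0.
  have [c [_ Ac] zc] := sup_adherent sz0 supA.
  by apply: Ac; rewrite az/= ltW//; move: zc; rewrite subKr.
have oks : ok s.
  move: as_; rewrite le_eqVlt => /predU1P[<-|as_].
    by apply: Aa.2; rewrite lexx.
  rewrite /ok; have := int_ge0 `]a, s]%classic.
  case E : (\int[mu]_(t in `]a, s]) v t)%E => [r| |]//; last first.
    by move=> _; rewrite addye// leey.
  move=> _; rewrite -EFinD lee_fin lerBlDr.
  apply: (cvgr_to_le (Fl s _)); first by rewrite as_.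
  near=> z; have : ok z by apply: okl; apply/andP; split; near: z;
    [exact: nbhs_left_ge | exact: nbhs_left_lt].
  rewrite /ok -lerBlDr -lee_fin => /le_trans; apply.
  rewrite EFinD -E leeD2r// ge0_subset_integral//; [exact: mvD|apply: subset_itvl].
  by rewrite bnd_simp; near: z; exact: nbhs_left_le.
have [<-//|sb'] := eqVneq s b; have {sb sb'} sb : s < b by rewrite lt_neqAle sb' sb.
(* If [ok] holds on a right neighbourhood of [s] of radius [d], then [s + d / 2] belongs to [A],
   against the choice of [s]. *)
suff : \forall z \near s^'+, ok z /\ z <= b.
  move=> [d /= d0 sd]; have Asd : A (s + d / 2).
    have sdb : s + d / 2 <= b.
      apply: (sd _ _ _).2 => /=; rewrite ?ltrDl ?divr_gt0//.
      rewrite opprD addrA subrr sub0r normrN gtr0_norm ?divr_gt0//.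
      by rewrite gtr_pMr// invf_lt1// ltr1n.
    split; first by rewrite sdb andbT ler_wpDr// divr_ge0// ltW.
    move=> z /andP[az]; have [zs _|sz zsd] := ltP z s; first by apply: okl; rewrite az.
    move: sz; rewrite le_eqVlt => /predU1P[<-//|sz]; apply: (sd _ _ _).1 => //=.
    rewrite distrC gtr0_norm ?subr_gt0// ltrBlDl (le_lt_trans zsd)// ltrD2l.
    by rewrite gtr_pMr// invf_lt1// ltr1n.
  by have := ub_le_sup (ex_intro _ b ubA) Asd; rewrite -/s gerDl leNgt divr_gt0.
suff : \forall z \near s^'+, ok z.
  by move=> okz; near=> z; split; near: z => //; exact: nbhs_right_le.
move: as_; rewrite le_eqVlt => /predU1P[<-|as_].
  near=> z; apply: (@le_trans _ _ e%:E); last by rewrite leeDr.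
  rewrite lee_fin lerBlDr; near: z; move/cvgr_le : Fa; apply.
  by rewrite ltrDr.
near=> z; rewrite /ok (intD _ s)//; last exact: ltW.
rewrite -(subrKA (F s)) addrC EFinD addeAC leeD//.
by near: z; apply: Fv; rewrite in_itv/= as_.
Unshelve. all: end_near. Qed.

(** The interval is cut into the level sets [E k] of [w], of height [d], and each is enlarged to an
    open set [U k]. Openness turns the pointwise slope bound into the local integral bound of
    [increment_le_integral]. *)
Lemma increment_le_integral_dini (R : realType) (F w : R -> R) (a b : R) :
  a < b -> {within `[a, b], continuous F} ->
  measurable_fun `]a, b[ w -> (forall x, x \in `]a, b[ -> 0 <= w x) ->
  (forall x, x \in `]a, b[ -> forall e, 0 < e -> \forall z \near x^'+,
    F z - F x <= (w x + e) * (z - x)) ->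
  ((F b - F a)%:E <= \int[lebesgue_measure]_(t in `]a, b[) (w t)%:E)%E.
Proof.
move=> ab cF mw w0 Fw; set mu := lebesgue_measure.
apply/lee_addgt0Pr => e e0.
have e20 : 0 < e / 2 by rewrite divr_gt0.
have ba0 : 0 < b - a by rewrite subr_gt0.
(* Rounding [w] up by [d] costs at most [e / 2] over the whole interval; the other half of [e] pays
   for enlarging the [E k]. *)
pose d := e / 2 / (b - a); have d0 : 0 < d by rewrite divr_gt0.
pose c (k : nat) : R := k.+1%:R * d.
have c0 k : 0 < c k by rewrite mulr_gt0.
pose E (k : nat) := `]a, b[%classic `&` w @^-1` `[k%:R * d, c k[%classic.
have mE k : measurable (E k) by apply: mw.
have muab : (mu `]a, b[%classic = (b - a)%:E)%E.
  by rewrite /mu lebesgue_measure_itv/= lte_fin ab.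
have muE k : (mu (E k) < +oo)%E.
  by apply: (@le_lt_trans _ _ (mu `]a, b[%classic));
    [apply: le_measure; rewrite ?inE//; [exact: mE|exact: subIsetl]|rewrite muab ltry].
(* The excess measure allowed for [U k] is divided by [c k], the weight that [v] gives to it, so
   that the costs sum to [e / 2]. *)
have ek0 k : 0 < e / 2 / (2 ^ k.+1)%:R / c k.
  by rewrite !divr_gt0// ltr0n expn_gt0.
have /choice[U UE] k :=
  lebesgue_regularity_outer (mE k) (muE k) (ek0 k).
have mU k : measurable (U k) by apply: open_measurable; case: (UE k).
pose vk k (t : R) : \bar R := ((c k)%:E * (\1_(U k) t)%:E)%E.
have vk0 k t : (0 <= vk k t)%E by rewrite mule_ge0// lee_fin// ltW.
(* [v] is a lower semicontinuous majorant of [w], as in the Vitali-Caratheodory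
   theorem: near each [x] in [E k] it dominates the slope [c k > w x]. *)
pose v t := (\sum_(0 <= k <oo) vk k t)%E.
have mvk k D : measurable_fun D (vk k).
  apply: measurable_funeM; apply/measurable_EFinP; exact: measurable_indic.
have mv : measurable_fun [set: R] v.
  by apply: ge0_emeasurable_sum => // k t _ _; exact: vk0.
have vc k t : U k t -> ((c k)%:E <= v t)%E.
  move=> Ut; rewrite /v (nneseriesD1 (n := k))//.
  rewrite /vk indicE mem_set// mule1 leeDl// nneseries_ge0// => n _ _.
  exact: vk0.
have Ew t : `]a, b[%classic t -> exists k, E k t.
  move=> tab; have := w0 t tab => wt0; exists (Num.truncn (w t / d)).
  split => //=; rewrite in_itv/= /c -ler_pdivlMr// -ltr_pdivrMr//.
  by rewrite truncn_itv// divr_ge0// ltW.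
apply: (@le_trans _ _ (\int[mu]_(t in `]a, b]) v t)%E).
  apply: increment_le_integral => //.
  - by move=> t; apply: nneseries_ge0 => n _ _; exact: vk0.
  move=> x xab; have [k Ekx] := Ew x xab.
  have [oU EU _] := UE k.
  have ewx : 0 < c k - w x.
    by case: Ekx => _; rewrite /= in_itv/= => /andP[_]; rewrite subr_gt0.
  have [r /= r0 xU] : nbhs x (U k) by apply: open_nbhs_nbhs; split => //; exact: EU.
  near=> z.
  apply: (@le_trans _ _ (\int[mu]_(t in `]x, z]) (cst (c k)%:E t))%E).
    rewrite integral_cst//= lebesgue_measure_itv/= lte_fin ifT; last first.
      by near: z; exact: nbhs_right_gt.
    rewrite -EFinB -EFinM lee_fin.
    by near: z; have := Fw x xab _ ewx; rewrite addrC subrK.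
  apply: ge0_le_integral => //=.
  - by move=> t _; rewrite lee_fin ltW.
  - exact: measurable_funTS.
  move=> t; rewrite in_itv/= => /andP[xt tz]; apply: vc.
  apply: xU => /=; rewrite distrC gtr0_norm ?subr_gt0// ltrBlDl.
  by apply: (le_lt_trans tz); near: z; apply: nbhs_right_lt; rewrite ltrDl.
have D0 : `]a, b[%classic = \bigcup_k E k.
  by apply/seteqP; split=> [t /Ew[k Ekt]|t [k _ []]//]; exists k.
have tE : trivIset [set: nat] E.
  apply/trivIsetP => i j _ _ ij; rewrite -subset0 => t [[_ /=]].
  rewrite in_itv/= => /andP[i1 i2] [_ /=]; rewrite in_itv/= => /andP[j1 j2].
  have := le_lt_trans j1 i2; have := le_lt_trans i1 j2.
  rewrite /c !ltr_pM2r// !ltr_nat !ltnS => ij' ji.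
  by move: ij; rewrite eqn_leq ij' ji.
have mwd D : D `<=` `]a, b[%classic -> measurable_fun D (fun t => (w t + d)%:E).
  move=> DD; apply/measurable_EFinP/measurable_funD => //.
  exact: (measurable_funS _ DD mw).
apply: (@le_trans _ _ (\sum_(0 <= k <oo)
    (\int[mu]_(t in E k) (w t + d)%:E + (e / 2 / (2 ^ k.+1)%:R)%:E))%E).
  rewrite integral_nneseries//; last by move=> k; exact: mvk.
  apply: lee_nneseries => k _; first by move=> _; apply: integral_ge0 => t _; exact: vk0.
  rewrite ge0_integralZl//; first last.
  - by rewrite lee_fin ltW.
  - by apply/measurable_EFinP; apply: measurable_indic; exact: mU.
  rewrite integral_indic//; last exact: mU.
  have [_ EU UeE] := UE k.
  apply: (@le_trans _ _ ((c k)%:E * (mu (E k) + mu (U k `\` E k)))%E).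
    rewrite lee_pmul2l ?lte_fin//.
    rewrite -measureU//; last by rewrite setDIK.
    - rewrite setDUK//; apply: le_measure; rewrite ?inE//; last exact: mU.
      by apply: measurableI => //; exact: mU.
    - exact: mE.
    - by apply: measurableD; [exact: mU|exact: mE].
  (* On [E k] one has [c k = k%:R * d + d <= w t + d]; the excess [U k] minus [E k] contributes at
     most the k-th share of [e / 2]. *)
  rewrite ge0_muleDr// leeD//.
    rewrite -integral_cst; last exact: mE.
    apply: ge0_le_integral => //=.
    - exact: mE.
    - by move=> t _; rewrite lee_fin ltW.
    - by apply: mwd; exact: subIsetl.
    move=> t [_ /=]; rewrite in_itv/= => /andP[wt _].
    by rewrite lee_fin /c -natr1 mulrDl mul1r lerD2r.
  rewrite (_ : e / 2 / _ = c k * (e / 2 / (2 ^ k.+1)%:R / c k))//; last first.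
    by rewrite [RHS]mulrC divfK// gt_eqF.
  by rewrite [leRHS]EFinM lee_pmul2l ?lte_fin// ltW.
apply: (le_trans (epsilon_trick _ _ _)).
- move=> k; apply: integral_ge0 => t [tab _].
  by rewrite lee_fin addr_ge0// ?w0// ltW.
- exact: ltW.
have wd0 t : `]a, b[%classic t -> (0 <= (w t + d)%:E)%E.
  by move=> tab; rewrite lee_fin addr_ge0// ?w0// ltW.
rewrite -ge0_integral_bigcup//; [|by rewrite -D0; exact: mwd|by rewrite -D0].
rewrite -D0; under eq_integral do rewrite EFinD.
rewrite ge0_integralD//; first last.
- by move=> t _; rewrite lee_fin ltW.
- exact/measurable_EFinP.
rewrite integral_cst//= lebesgue_measure_itv/= lte_fin ab -EFinB -EFinM /d.
rewrite divfK ?gt_eqF//.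
by rewrite -addeA -EFinD -splitr.
Unshelve. all: end_near. Qed.

Lemma increment_le_integral_integrable (R : realType) (F g : R -> R) (a b : R) :
  a < b -> {within `[a, b], continuous F} ->
  lebesgue_measure.-integrable `]a, b[ (EFin \o g) ->
  (forall x, x \in `]a, b[ -> forall e, 0 < e -> \forall z \near x^'+,
    F z - F x <= (g x + e) * (z - x)) ->
  ((F b - F a)%:E <= \int[lebesgue_measure]_(t in `]a, b[) (g t)%:E)%E.
Proof.
move=> ab cF ig Fg; set mu := lebesgue_measure.
have mg : measurable_fun `]a, b[ g.
  by apply/measurable_EFinP; exact: (measurable_int _ ig).
(* Truncating [g] below at [- m] and adding [m] makes it non-negative; then
   [m] tends to infinity. *)
pose gm (m : nat) t := Num.max (g t) (- m%:R).
have mgm m : measurable_fun `]a, b[ (gm m) by exact: measurable_maxr.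
have gm_le m t : `|gm m t| <= `|g t|.
  rewrite /gm; have [gt|gt] := leP (g t) (- m%:R)=> //.
  by rewrite normrN ger0_norm// ler_normr; apply/orP; right; rewrite lerNr.
have igm m : mu.-integrable `]a, b[ (EFin \o gm m).
  apply: (le_integrable _ _ _ ig) => //; first by apply/measurable_EFinP; exact: mgm.
  by move=> t _ /=; rewrite lee_fin.
have Fgm m : ((F b - F a)%:E <= \int[mu]_(t in `]a, b[) (gm m t)%:E)%E.
  have icst : mu.-integrable `]a, b[ (EFin \o cst (m%:R : R)).
    apply/integrableP; split; first exact/measurable_EFinP.
    rewrite (eq_integral (cst (m%:R)%:E)).
      rewrite integral_cst//= lebesgue_measure_itv/= lte_fin ab.
      by rewrite -EFinB -EFinM ltry.
    by move=> t _ /=; rewrite ger0_norm.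
  rewrite -(@leeD2rE _ (m%:R * (b - a))%:E)// -EFinD.
  have -> : (m%:R * (b - a))%:E = (\int[mu]_(t in `]a, b[) (m%:R)%:E)%E.
    rewrite (integral_cst _ _ (m%:R)%:E)//= lebesgue_measure_itv/= lte_fin ab.
    by rewrite -EFinB -EFinM.
  rewrite -integralD_EFin//.
  have := @increment_le_integral_dini _ (fun z => F z + m%:R * z)
    (fun t => gm m t + m%:R) _ _ ab.
  rewrite opprD addrACA -mulrBr; apply.
  - move=> x; apply: cvgD; first exact: cF.
    by apply: continuous_subspaceT => y; exact: mulrl_continuous.
  - exact: measurable_funD.
  - by move=> x xab; rewrite -lerBlDr sub0r /gm le_max lexx orbT.
  (* Truncation from below only raises [g], so the slope bound for [g] is also one for [gm m]. *)
  - move=> x xab e e0; near=> z.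
    rewrite opprD addrACA -mulrBr.
    apply: (@le_trans _ _ ((g x + e) * (z - x) + m%:R * (z - x))).
      by rewrite lerD2r; near: z; exact: Fg.
    rewrite -mulrDl addrAC ler_wpM2r// ?subr_ge0 ?lerD2r ?le_max ?lexx//.
have [|||||_ _ cvgm] := @dominated_convergence _ _ _ mu `]a, b[%classic
  (measurable_itv _) (fun m => EFin \o gm m) (EFin \o g) (abse \o (EFin \o g)).
- by move=> m; apply/measurable_EFinP; exact: mgm.
- exact: (measurable_int _ ig).
- apply: aeW => t tab; apply/cvg_EFin; first by apply: nearW.
  rewrite /comp/=; apply: cvg_near_cst.
  exists (Num.truncn `|g t|).+1 => // m /= tm.
  rewrite /gm max_l//.
  rewrite lerNl (le_trans (ler_norm _))// normrN (le_trans (ltW (truncnS_gt _)))//.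
  by rewrite ler_nat.
- exact: integrable_abse.
- by apply: aeW => t m _ /=; rewrite lee_fin.
apply: (cvge_to_ge cvgm).
by apply: nearW => m; exact: Fgm.
Unshelve. all: end_near. Qed.

(** The one-sided inequality is applied to [F] and [g], then to [- F] and [- g]. *)
Lemma integral_right_derivative (R : realType) (F g : R -> R) (a b : R) :
  a < b -> {within `[a, b], continuous F} ->
  lebesgue_measure.-integrable `]a, b[ (EFin \o g) ->
  (forall x, x \in `]a, b[ -> forall e, 0 < e -> \forall z \near x^'+,
    `|F z - F x - g x * (z - x)| <= e * (z - x)) ->
  (\int[lebesgue_measure]_(t in `]a, b[) (g t)%:E = (F b - F a)%:E)%E.
Proof.
move=> ab cF ig Fg; apply/le_anti/andP; split; last first.
  apply: increment_le_integral_integrable => // x xab e e0.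
  near=> z; rewrite mulrDl -lerBlDl; apply: le_trans (ler_norm _) _.
  by near: z; exact: Fg.
rewrite -leeN2 -integralN; last first.
  exact: integrable_add_def.
under eq_integral do rewrite -EFinN.
rewrite -EFinN opprD.
apply: (@increment_le_integral_integrable _ (- F) (fun z => - g z)) => //.
- by move=> x; apply: cvgN; exact: cF.
- exact: integrableN ig.
move=> x xab e e0; near=> z; rewrite mulrDl -lerBlDl mulNr -!opprD.
apply: le_trans (ler_norm _) _; rewrite normrN.
  by near: z; exact: Fg.
Unshelve. all: end_near. Qed.

(** * The distance [rho] and measurability of evaluation *)

Lemma ndrc_ge0 (R : realType) (phi : ndrc R) (y : R) : 0 <= phi y.
Proof.
have [y0|y0] := ltP y 0; first by rewrite ndrc_neg0.
rewrite -(@ndrc_neg0 _ phi (-1)) ?ltrN10//.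
by apply: ndrc_mono; rewrite (le_trans _ y0)// lerN10.
Qed.

Lemma rhoK_lt (R : realType) (K d : R) (phi psi : ndrc R) :
  0 <= K -> rhoK K phi psi < d ->
  exists2 e, 0 < e < d & forall y, 0 <= y <= K ->
    phi (y - e) - e <= psi y <= phi (y + e) + e.
Proof.
move=> K0.
rewrite /rhoK => /inf_lt[].
  have psiK := ndrc_ge0 psi K.
  (* The set must be shown non-empty, since [inf] of the empty set is a default value. This [e]
     exceeds [K], so [phi (y - e) = 0], and is at least [psi K], so it bounds [psi] on [[0, K]]. *)
  exists (K + 1 + psi K); split; first lra.
  move=> y /andP[y0 yK].
  have := @ndrc_mono _ psi _ _ yK; have := ndrc_ge0 psi y.
  have := ndrc_ge0 phi (y + (K + 1 + psi K)).
  by rewrite (@ndrc_neg0 _ phi (y - _)); lra.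
by move=> e [e0 He] ed; exists e; rewrite ?e0.
Qed.

(** A single term is bounded by the sum of a series of non-negative terms, once convergence is
    obtained by comparison with the geometric series. The index [n.+1] reflects that the series
    starts at 1. *)
Lemma rhoK_le_rho (R : realType) (n : nat) (phi psi : ndrc R) :
  2 ^- n.+1 * Num.min (rhoK n.+1%:R phi psi) 1 <= rho phi psi.
Proof.
pose u n := 2 ^- n * Num.min (rhoK n%:R phi psi) 1 : R.
have rhoK_ge0 k : 0 <= rhoK k%:R phi psi.
  rewrite leNgt; apply/negP => /(rhoK_lt (ler0n _ k))[e /andP[e0 /(lt_trans e0)]].
  by rewrite ltxx.
have u0 k : 0 <= u k.
  by rewrite /u mulr_ge0// ?invr_ge0 ?exprn_ge0// le_min rhoK_ge0 ler01.
have ndu : nondecreasing_seq (fun m => \sum_(1 <= i < m) u i).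
  apply/nondecreasing_seqP => -[|m]; first by rewrite !big_geq.
  by rewrite [leRHS]big_nat_recr//= lerDl.
have sum_half m : \sum_(1 <= i < m.+1) u i <= 1 - 2 ^- m.
  elim: m => [|m IH]; first by rewrite big_geq// expr0 invr1 subrr.
  rewrite big_nat_recr//=; apply: (le_trans (lerD IH _)).
    by apply: (@ler_wpM2l _ (2 ^- m.+1) _ _ 1);
      rewrite ?invr_ge0 ?exprn_ge0// ge_min lexx orbT.
  rewrite mulr1 -addrA lerD2l exprS invfM.
  by rewrite lerNr opprD opprK -lerBlDr; lra.
have cu : cvgn (fun m => \sum_(1 <= i < m) u i).
  apply: nondecreasing_is_cvgn => //; exists 1 => _ [[|m] _ <-].
    by rewrite big_geq.
  by rewrite (le_trans (sum_half _))// gerBl invr_ge0 exprn_ge0.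
apply: le_trans (nondecreasing_cvgn_le ndu cu n.+2).
rewrite big_nat_recr//= lerDr; exact: sumr_ge0.
Qed.

(** The condition [c < phi y] is not open in general, because [phi] may jump at [y]. Exceeding [c]
    strictly before [y] is open: a perturbation of size [e] moves [z] to [z + e] and lowers the
    value by at most [e]. *)
Lemma rho_open_exceed (R : realType) (c y : R) : 0 <= c ->
  rho_open [set phi : ndrc R | exists2 z, z < y & c < phi z].
Proof.
move=> c0 phi [z zy cz].
have z0 : 0 <= z.
  by rewrite leNgt; apply/negP => z0; move: cz; rewrite ndrc_neg0// ltNge c0.
(* The window [[0, N.+1]] contains [y], hence also the shifted point [z + e]. *)
pose N := Num.truncn y.
have yN : y < N.+1%:R by exact: truncnS_gt.
(* The cap at 1 ensures that [Num.min (rhoK _ _ _) 1 < d] forces [rhoK _ _ _ < d]. *)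
pose d := Num.min (Num.min (y - z) (phi z - c)) 1.
have d0 : 0 < d by rewrite !lt_min !subr_gt0 zy cz ltr01.
exists (2 ^- N.+1 * d); first by rewrite mulr_gt0// invr_gt0 exprn_gt0.
move=> psi /(le_lt_trans (rhoK_le_rho N phi psi)).
have d1 : d <= 1 by rewrite /d ge_min lexx orbT.
rewrite ltr_pM2l ?invr_gt0 ?exprn_gt0// gt_min.
move=> /orP[|/lt_le_trans/(_ d1)]; last by rewrite ltxx.
move=> /rhoK_lt[//|e /andP[e0]].
rewrite /d !lt_min -andbA => /and3P[ezy ecz _] psiE.
exists (z + e); first by rewrite -ltrBrDl.
have /andP[+ _] : phi (z + e - e) - e <= psi (z + e) <= phi (z + e + e) + e.
  by apply: psiE; lra.
rewrite addrK; apply: lt_le_trans; lra.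
Qed.

(** This passes from measurability for the Borel sigma-algebra of [rho] to measurability of the
    values at points. *)
Lemma measurable_ndrc_eval (R : realType) (y : R) :
  measurable_fun [set: ndrc_borel R] (fun phi : ndrc_borel R => phi y).
Proof.
apply: (measurability _ (RGenOInfty.measurableE R)).
move=> _ [_ [c ->] <-]; rewrite setTI.
have [c0|c0] := ltP c 0.
  rewrite (_ : _ @^-1` _ = setT)//; apply/seteqP; split=> // phi _ /=.
  by rewrite in_itv/= andbT (lt_le_trans c0)// ndrc_ge0.
(* The margin [m.+1%:R^-1] keeps the inequality strict after the limit in [k]. *)
rewrite (_ : _ @^-1` _ = \bigcup_m \bigcap_k
    [set phi : ndrc_borel R | exists2 z, z < y + k.+1%:R^-1 &
      c + m.+1%:R^-1 < phi z]).
  apply: bigcupT_measurable => m; apply: bigcapT_measurable => k.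
  by apply: sub_sigma_algebra; apply: rho_open_exceed; rewrite addr_ge0.
(* Right continuity of [phi] makes the two sets equal. *)
apply/seteqP; split=> phi /=.
  rewrite in_itv/= andbT => cy.
  have [m mc] : exists m, c + m.+1%:R^-1 < phi y.
    have cy0 : 0 < phi y - c by rewrite subr_gt0.
    have [m mc] := ltr_add_invr cy.
    by exists m.
  by exists m => // k _; exists y => //; rewrite ltrDl invr_gt0.
move=> [m _ phim]; rewrite in_itv/= andbT.
apply: (@lt_le_trans _ _ (c + m.+1%:R^-1)); first by rewrite ltrDl invr_gt0.
apply: (cvgr_to_ge (@ndrc_rcont _ phi y)).
near=> t.
have ty : y < t by [].
have [k kt] := ltr_add_invr ty.
have [z zk /ltW /le_trans] := phim k I; apply.
by apply: ndrc_mono; exact: ltW (lt_trans zk kt).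
Unshelve. all: end_near. Qed.

(** * Generalized inverses *)

(** The generalized inverse of [phi] at [x]; [dual] is this inverse taken on the time-reversed
    family. *)
Definition first_exceedance (R : realType) (x : R) (phi : ndrc R) : \bar R :=
  ereal_inf [set y%:E | y in [set y : R | 0 <= y /\ x < phi y]].

Lemma first_exceedance_ge0 (R : realType) (x : R) (phi : ndrc R) :
  (0 <= first_exceedance x phi)%E.
Proof. by apply/ereal_infP => _ [y [y0 _] <-]; rewrite lee_fin. Qed.

Lemma first_exceedance_le (R : realType) (x y : R) (phi : ndrc R) :
  0 <= y -> x < phi y -> (first_exceedance x phi <= y%:E)%E.
Proof. move=> y0 xy; by apply: ge_ereal_inf; exists y%:E => //; exists y. Qed.

Lemma first_exceedance_lt (R : realType) (x y : R) (phi : ndrc R) :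
  (first_exceedance x phi < y%:E)%E -> x < phi y.
Proof.
move=> /ereal_inf_lt[_ [z [z0 xz] <-]]; rewrite lte_fin => zy.
by apply: (lt_le_trans xz); apply: ndrc_mono; exact: ltW.
Qed.

(** Every [z > y] has [x < phi z], and right continuity preserves only the weak inequality. Together
    with [first_exceedance_le], for [0 <= y], this leaves only the case [phi y = x] undecided. *)
Lemma le_first_exceedance (R : realType) (x y : R) (phi : ndrc R) :
  (first_exceedance x phi <= y%:E)%E -> x <= phi y.
Proof.
move=> fy; apply: (cvgr_to_ge (@ndrc_rcont _ phi y)).
near=> z; apply/ltW/first_exceedance_lt; apply: (le_lt_trans fy).
by rewrite lte_fin.
Unshelve. all: end_near. Qed.

(** The inverse is at most [y] exactly when [phi] exceeds [x] at every [y + k.+1%:R^-1], a countable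
    condition on evaluations. As [0 <= x], such points are automatically non-negative. *)
Lemma measurable_first_exceedance (R : realType) (x : R) : 0 <= x ->
  measurable_fun [set: ndrc_borel R] (first_exceedance x).
Proof.
move=> x0; apply: (measurability _ (ErealGenOInfty.measurableE R)).
move=> _ [_ [y ->] <-]; rewrite setTI.
rewrite (_ : _ @^-1` _ = ~` \bigcap_k
    ((fun phi : ndrc_borel R => phi (y + k.+1%:R^-1)) @^-1` `]x, +oo[)); last first.
  rewrite -[LHS]setCK; congr (~` _); apply/seteqP; split=> phi /=.
    rewrite in_itv/= andbT => /negP; rewrite -leNgt => fy k _ /=.
    rewrite in_itv/= andbT; apply: first_exceedance_lt.
    by apply: (le_lt_trans fy); rewrite lte_fin ltrDl invr_gt0.
  rewrite in_itv/= andbT => fy; apply/negP; rewrite -leNgt.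
  apply/lee_addgt0Pr => e e0.
  have ye : y < y + e by rewrite ltrDl.
  have [k /ltW kye] := ltr_add_invr ye.
  apply: (@le_trans _ _ (y + k.+1%:R^-1)%:E); last by rewrite -EFinD lee_fin.
  have := fy k I; rewrite /= in_itv/= andbT => xk.
  apply: first_exceedance_le => //; rewrite leNgt; apply/negP => yk0.
  by move: xk; rewrite ndrc_neg0// ltNge x0.
apply: measurableC; apply: bigcapT_measurable => k.
by rewrite -[_ @^-1` _]setTI; apply: measurable_ndrc_eval.
Qed.

(** * Truncated expectations at a random point *)

Section truncated_expectation.
Context {d : measure_display} {Omega : measurableType d} {R : realType}.
Variable P : probability Omega R.
Variable tau : Omega -> \bar R.
Hypothesis mtau : measurable_fun setT tau.
Hypothesis tau_ge0 : forall w, (0 <= tau w)%E.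
Variable f : R -> R.
Hypothesis cf : continuous f.
Variable C : R.
Hypothesis fC : forall y, `|f y| <= C.

Let A (y : R) : set Omega := [set w | (tau w <= y%:E)%E].

Let mA y : measurable (A y).
Proof. by rewrite -[A y]setTI; exact: emeasurable_fun_infty_c. Qed.

Definition distr_fun (y : R) : R := fine (P (A y)).

(* Formally the integral of [f' * distr_fun] over [0, y], but defined without
   any integrability of [f']. *)
Definition truncated_exp (y : R) : R :=
  \int[P]_(w in A y) (f y - f (fine (tau w))).

Let mf : measurable_fun [set: Omega] (f \o fine \o tau).
Proof.
apply: measurableT_comp; last exact: mtau.
apply: measurableT_comp; first exact: continuous_measurable_fun.
exact: fine_measurable.
Qed.

Let intf D r : measurable D ->
  P.-integrable D (EFin \o (fun w => r - f (fine (tau w)))).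
Proof.
move=> mD; apply: measurable_bounded_integrable => //.
- by rewrite (le_lt_trans (probability_le1 P mD))// ltry.
- by apply: measurable_funTS; exact: measurable_funB.
- exists (`|r| + C); split; first exact: num_real.
  move=> M rM w _ /=; apply: (le_trans (ler_normB _ _)).
  by apply: ltW; apply: le_lt_trans rM; rewrite lerD2l.
Qed.

Lemma distr_fun_ge0 y : 0 <= distr_fun y.
Proof. exact: fine_ge0. Qed.

Lemma distr_fun_le1 y : distr_fun y <= 1.
Proof. by rewrite -lee_fin fineK ?fin_num_measure// probability_le1. Qed.

Let sub_A y z : y <= z -> A y `<=` A z.
Proof. by move=> yz w /le_trans; apply; rewrite lee_fin. Qed.

Let PAD y z : y <= z -> fine (P (A z `\` A y)) = distr_fun z - distr_fun y.
Proof.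
move=> yz; rewrite measureD//; last by rewrite ltey_eq fin_num_measure.
by rewrite setIidr ?fineB ?fin_num_measure//; exact: sub_A.
Qed.

Lemma distr_fun_nd : {homo distr_fun : y z / y <= z}.
Proof. by move=> y z yz; rewrite -subr_ge0 -PAD// fine_ge0. Qed.

(** Continuity of [P] from above along the events [B n], which decrease to the empty set;
    monotonicity then covers all nearby [z]. *)
Lemma distr_fun_rcont y e : 0 < e ->
  \forall z \near y^'+, distr_fun z - distr_fun y <= e.
Proof.
move=> e0; pose B n := A (y + n.+1%:R^-1) `\` A y.
have yn (n : nat) : y <= y + n.+1%:R^-1 by rewrite lerDl.
have mB n : measurable (B n) by exact: measurableD.
have B0 : \bigcap_n B n = set0.
  rewrite -subset0 => w Bw; have [_] := Bw 0 I; apply.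
  apply/lee_addgt0Pr => r r0.
  have yr : y < y + r by rewrite ltrDl.
  have [n /ltW nr] := ltr_add_invr yr.
  have [/le_trans + _] := Bw n I; apply; first by rewrite lee_fin.
have : (P \o B) x @[x --> \oo] --> P (\bigcap_n B n).
  apply: nonincreasing_cvg_mu => //.
  - by rewrite ltey_eq fin_num_measure.
  - by rewrite B0.
  - move=> m n mn; apply/subsetPset; apply: setSD; apply: sub_A.
    by rewrite lerD2l lef_pV2 ?posrE// ler_nat.
rewrite B0 measure0 => /fine_cvgP[_ /cvgr_le/(_ _ e0)][n _ /(_ n (leqnn n))].
rewrite /= PAD// => Fn.
have ynlt : y < y + n.+1%:R^-1 by rewrite ltrDl.
near=> z; apply: le_trans Fn; rewrite lerB//; apply: distr_fun_nd.
by near: z; exact: nbhs_right_le.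
Unshelve. all: end_near. Qed.

(** On [A y] the integrand changes by the constant [f z - f y], which gives the main term. What
    remains is an integral over the event that [tau] lies in []y, z]], where the integrand is at
    most [K]. *)
Lemma truncated_exp_increment y z K : y <= z ->
  (forall u, y <= u <= z -> `|f z - f u| <= K) ->
  `|truncated_exp z - truncated_exp y - (f z - f y) * distr_fun y| <=
  K * (distr_fun z - distr_fun y).
Proof.
move=> yz fK.
have mD : measurable (A z `\` A y) by exact: measurableD.
have intAy : \int[P]_(w in A y) (f z - f (fine (tau w))) =
    (f z - f y) * distr_fun y + truncated_exp y.
  rewrite /distr_fun -Rintegral_cst// -RintegralD//; last exact: intf.
    by apply: eq_Rintegral => w _; rewrite addrA subrK.
  by apply: finite_measure_integrable_cst.
have -> : truncated_exp z - truncated_exp y - (f z - f y) * distr_fun y =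
    \int[P]_(w in A z `\` A y) (f z - f (fine (tau w))).
  rewrite {1}/truncated_exp -(setDUK (sub_A yz)) Rintegral_setU//.
  - rewrite intAy setDUK; [ring|exact: sub_A].
  - by apply: intf; rewrite setDUK//; exact: sub_A.
  - by apply/disj_setPS => w [? []].
rewrite -PAD// -Rintegral_cst//.
apply: (le_trans (le_normr_Rintegral _ _)) => //; first exact: intf.
apply: le_Rintegral => //.
- apply: (integrable_norm (intf (f z) mD)).
- exact: finite_measure_integrable_cst.
- move=> w [Azw /negP Ayw]; apply: fK.
  move: Azw Ayw; rewrite /A /= -ltNge.
  by case: (tau w) => //= t; rewrite lee_fin lte_fin => -> /ltW ->.
Qed.

(** Jumps of [distr_fun] do no harm, since they are multiplied by the oscillation of [f]. *)
Lemma continuous_truncated_exp : continuous truncated_exp.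
Proof.
move=> y; apply/cvgrPdist_le => e e0.
(* Two values within [e / 4] of [f y] differ by at most [e / 2], and this bound enters twice: in the
   main term and as the constant [K]. *)
have e40 : 0 < e / 4 by rewrite divr_gt0.
have /cvgrPdist_le/(_ _ e40)[r /= r0 fr] := @cf y.
have fr2 u v : `|y - u| < r -> `|y - v| < r -> `|f v - f u| <= e / 2.
  move=> /fr fu /fr fv.
  move: fu fv; rewrite !ler_norml; lra.
have incr u v : `|y - u| < r -> `|y - v| < r -> u <= v ->
    `|truncated_exp v - truncated_exp u| <= e.
  move=> yu yv uv.
  have fK s : u <= s <= v -> `|f v - f s| <= e / 2.
    move=> /andP[us sv]; apply: fr2 => //.
    move: yu yv; rewrite !ltr_norml; lra.
  have := truncated_exp_increment uv fK.
  have := fr2 _ _ yu yv.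
  have := distr_fun_ge0 u; have := distr_fun_le1 v.
  have := distr_fun_le1 u; have := distr_fun_nd uv.
  rewrite !ler_norml; nra.
exists r => // z /= yz; have yy : `|y - y| < r by rewrite subrr normr0.
have [zy|/ltW yz'] := leP z y; first exact: incr.
by rewrite distrC; exact: incr.
Qed.

(** The error [K * (distr_fun z - distr_fun y)] is of smaller order than [z - y]: [K] is of order
    [z - y], and the other factor tends to 0 because [distr_fun] is right continuous. Left
    continuity may fail, hence a derivative from the right. *)
Lemma truncated_exp_rderiv y f' :
  (forall e, 0 < e -> \forall z \near y^'+,
    `|f z - f y - f' * (z - y)| <= e * (z - y)) ->
  forall e, 0 < e -> \forall z \near y^'+,
    `|truncated_exp z - truncated_exp y - (f' * distr_fun y) * (z - y)|
      <= e * (z - y).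
Proof.
move=> fy e e0.
have e20 : 0 < e / 2 by rewrite divr_gt0.
(* Close to [y] on the right, [f u] differs from [f y] by at most [(|f'| + 1) * (u - y)]; comparing
   [f z] with [f u] through [f y] doubles the constant. *)
pose M := 2 * (`|f'| + 1).
have M0 : 0 < M by rewrite mulr_gt0// ltr_wpDl.
have [r /= r0 fr] := fy 1 ltr01.
near=> z.
have yz : y < z by [].
have zr : z - y < r.
  by rewrite ltrBlDl; near: z; apply: nbhs_right_lt; rewrite ltrDl.
have f1 u : y <= u <= z -> `|f u - f y| <= (`|f'| + 1) * (u - y).
  rewrite le_eqVlt => /andP[/predU1P[<-|yu] uz].
    by rewrite !subrr normr0 mulr0.
  have uy0 : 0 < u - y by rewrite subr_gt0.
  have fu : `|f u - f y - f' * (u - y)| <= 1 * (u - y).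
    by apply: fr => //=; rewrite distrC gtr0_norm// (le_lt_trans _ zr)// lerD2r.
  rewrite -(subrK (f' * (u - y)) (f u - f y)) (le_trans (ler_normD _ _))//.
  by rewrite mulrDl addrC lerD// normrM (gtr0_norm uy0).
have fK u : y <= u <= z -> `|f z - f u| <= M * (z - y).
  move=> yuz; have fu := f1 _ yuz.
  have fz : `|f z - f y| <= (`|f'| + 1) * (z - y) by apply: f1; rewrite lexx ltW.
  have uz : (`|f'| + 1) * (u - y) <= (`|f'| + 1) * (z - y).
    by case/andP: yuz => _ uz; rewrite ler_wpM2l ?lerD2r// addr_ge0.
  rewrite -(subrKA (f y)) (le_trans (ler_normD _ _))// (distrC (f y)).
  rewrite /M; lra.
have := truncated_exp_increment (ltW yz) fK.
set T := truncated_exp z - _; set D := distr_fun z - _ => TD.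
have DM : M * (z - y) * D <= e / 2 * (z - y).
  rewrite mulrAC ler_wpM2r ?subr_ge0 ?(ltW yz)// mulrC -ler_pdivlMr//.
  by rewrite /D; near: z; apply: distr_fun_rcont; rewrite divr_gt0.
have fz : `|f z - f y - f' * (z - y)| <= e / 2 * (z - y) by near: z; exact: fy.
have -> : T - f' * distr_fun y * (z - y) = (T - (f z - f y) * distr_fun y) +
    (f z - f y - f' * (z - y)) * distr_fun y by ring.
have -> : e * (z - y) = e / 2 * (z - y) + e / 2 * (z - y) by field.
rewrite (le_trans (ler_normD _ _))// lerD ?(le_trans TD)//.
rewrite normrM (ger0_norm (distr_fun_ge0 _)).
by rewrite (le_trans _ fz)// ler_piMr// distr_fun_le1.
Unshelve. all: end_near. Qed.

Lemma truncated_exp0 : truncated_exp 0 = 0.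
Proof.
transitivity (\int[P]_(w in A 0) (0 : R)); last by rewrite Rintegral_cst// mul0r.
apply: eq_Rintegral => w; rewrite inE /A /= => tau0.
have -> : tau w = 0%:E by apply/le_anti; rewrite tau0 tau_ge0.
by rewrite subrr.
Qed.

Lemma expectation_truncated_exp b : f 0 = 0 -> (forall y, b <= y -> f y = 0) ->
  ('E_P[fun w => f (fine (tau w))] = (- truncated_exp b)%:E)%E.
Proof.
move=> f0 fb; rewrite unlock.
transitivity (\int[P]_(w in A b) (- (f b - f (fine (tau w))))%:E)%E.
  rewrite [RHS]integral_mkcond; apply: eq_integral => w _.
  rewrite patchE; case: ifPn => [_|]; first by rewrite (fb b)// sub0r opprK.
  rewrite notin_setE /A /= => /negP; rewrite -ltNge.
  (* As [fine +oo] is 0, the case [tau w = +oo] contributes [f 0 = 0]. *)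
  by case: (tau w) => [t| |]//=; rewrite ?f0// lte_fin => /ltW/fb ->.
have iA := intf (f b) (mA b).
under eq_integral do rewrite EFinN.
rewrite integralN; last exact: integrable_add_def.
rewrite EFinN; congr (- _)%E; rewrite fineK//; exact: integrable_fin_num.
Qed.

End truncated_expectation.

(** * Duality in law *)

(** The probability is squeezed between those of [x < Z w y] and [x <= Z w y]. Equality in law
    carries both to [Z'], where the absence of an atom at [x] makes them equal. *)
Lemma first_exceedance_law (d : measure_display) (Omega : measurableType d)
    (R : realType) (P : probability Omega R) (Z Z' : Omega -> ndrc_borel R)
    (x y : R) :
  0 <= x -> 0 <= y ->
  measurable_fun [set: Omega] Z -> measurable_fun [set: Omega] Z' ->
  same_law P Z Z' -> P [set w | Z' w y = x] = 0%E ->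
  P [set w | (first_exceedance x (Z w) <= y%:E)%E] = P [set w | x < Z' w y].
Proof.
move=> x0 y0 mZ mZ' ZZ' noatom.
pose ev := (fun phi : ndrc_borel R => phi y).
have mev B : measurable B -> measurable (ev @^-1` B).
  by move=> mB; rewrite -[_ @^-1` _]setTI; exact: measurable_ndrc_eval.
have mevZ (Z0 : Omega -> ndrc_borel R) B : measurable_fun [set: Omega] Z0 ->
    measurable B -> measurable (Z0 @^-1` (ev @^-1` B)).
  by move=> mZ0 mB; rewrite -[_ @^-1` _]setTI; apply: mZ0 => //; exact: mev.
have gtE (Z0 : Omega -> ndrc_borel R) :
    [set w | x < Z0 w y] = Z0 @^-1` (ev @^-1` `]x, +oo[).
  by apply/seteqP; split=> w /=; rewrite in_itv/= andbT.
have geE (Z0 : Omega -> ndrc_borel R) :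
    [set w | x <= Z0 w y] = Z0 @^-1` (ev @^-1` `[x, +oo[).
  by apply/seteqP; split=> w /=; rewrite in_itv/= andbT.
have eqE (Z0 : Omega -> ndrc_borel R) :
    [set w | Z0 w y = x] = Z0 @^-1` (ev @^-1` [set x]) by [].
have mfe : measurable [set w | (first_exceedance x (Z w) <= y%:E)%E].
  rewrite -[X in measurable X]setTI; apply: emeasurable_fun_infty_c => //.
  by apply: measurableT_comp => //; exact: measurable_first_exceedance.
apply/le_anti/andP; split.
  apply: (@le_trans _ _ (P [set w | x <= Z w y])).
    apply: le_measure; rewrite ?inE ?geE//; first exact: mevZ.
    by rewrite -geE => w; exact: le_first_exceedance.
  rewrite geE ZZ'; last exact: mev.
  rewrite -geE (_ : [set w | x <= _] = [set w | x < Z' w y] `|` [set w | Z' w y = x]).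
    rewrite measureU0// ?gtE ?eqE; exact: mevZ.
  apply/seteqP; split=> w /=.
    by rewrite le_eqVlt => /predU1P[->|]; [right|left].
  by move=> [/ltW//|->].
rewrite gtE -ZZ' -?gtE; last exact: mev.
apply: le_measure; rewrite ?inE ?gtE//; first exact: mevZ.
by rewrite -gtE => w; exact: first_exceedance_le.
Qed.

(** * Regularity and support of the test function *)

Lemma derivable_right_increment (R : realType) (f : R -> R) (y : R) :
  derivable f y 1 -> forall e, 0 < e -> \forall z \near y^'+,
    `|f z - f y - derive1 f y * (z - y)| <= e * (z - y).
Proof.
move=> fy e e0; rewrite derive1E.
have /cvgrPdist_le/(_ _ e0)[r /= r0 fr] : 
  h^-1 *: (f (h *: 1 + y) - f y) @[h --> 0^'] --> 'D_1 f y by [].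
near=> z.
have yz : 0 < z - y by rewrite subr_gt0.
have : `|'D_1 f y - (z - y)^-1 *: (f ((z - y) *: 1 + y) - f y)| <= e.
  apply: fr => /=; last by rewrite gt_eqF.
  rewrite sub0r normrN gtr0_norm// ltrBlDl; near: z; apply: nbhs_right_lt.
  by rewrite ltrDl.
rewrite scaler1 subrK /GRing.scale/= -(ler_pM2r yz); apply: le_trans.
rewrite -[X in _ <= _ * X](gtr0_norm yz) -normrM -[leRHS]normrN.
set q := (z - y)^-1; have qzy : q * (z - y) = 1 by rewrite mulVf ?gt_eqF.
by rewrite mulrBl mulrAC qzy mul1r opprB.
Unshelve. all: end_near. Qed.

(** Extending [f] by the constant [f 0] to the left gives a function continuous on the whole line.
    Right continuity at 0 follows on multiplying the convergent difference quotient by [h]. *)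
Lemma continuous_max0 (R : realType) (f : R -> R) :
  differentiable_nneg f -> continuous (fun y : R => f (Num.max y 0) : R).
Proof.
move=> [df f0] y.
have [y0|y0|->] := ltgtP y 0.
- apply: cvg_near_cst.
  near=> z. congr f.
  by rewrite !max_r ?ltW//; near: z; exact: lt_nbhsl.
- apply: (@continuous_comp _ _ _ (fun y : R => Num.max y 0) f).
    have := @continuous_max _ _ (id : R -> R) (cst 0) y.
    by apply; [exact: cvg_id|exact: cvg_cst].
  rewrite max_l ?ltW//; apply: differentiable_continuous.
  by apply/derivable1_diffP; exact: df.
apply/left_right_continuousP; rewrite maxxx; split.
  apply: cvg_near_cst; near=> z; congr f.
  by apply/max_r.
have : h * (h^-1 * (f h - f 0)) @[h --> 0^'+] -->
  0 * lim (h^-1 * (f h - f 0) @[h --> 0^'+]).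
  by apply: cvgM => //; apply: cvg_at_right_filter; exact: cvg_id.
rewrite mul0r => fh; apply/subr_cvg0; apply: cvg_trans fh.
apply: near_eq_cvg; near=> h.
have h0 : 0 < h by [].
by rewrite mulrA mulfV ?gt_eqF// mul1r max_l// ltW.
Unshelve. all: end_near. Qed.

Lemma compact_support_nneg_bounded (R : realType) (f : R -> R) :
  compact_support_nneg f -> exists2 M, 0 < M & forall y, M < y -> f y = 0.
Proof.
move=> /compact_bounded[M [_ fM]].
exists (`|M| + 1); first by rewrite ltr_wpDl.
move=> y My; apply: contrapT => /eqP fy.
have M1 : M < `|M| + 1 by rewrite (le_lt_trans (ler_norm M))// ltrDl.
have y0 : 0 <= y by rewrite (le_trans _ (ltW My))// addr_ge0.
have /= yM := fM _ M1 y (subset_closure (conj y0 fy)).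
by have := le_lt_trans (le_trans (ler_norm y) yM) My; rewrite ltxx.
Qed.

Theorem theorem4p0p4 (R : realType) (d : measure_display)
    (Omega : measurableType d) (P : probability Omega R)
    (x T : R) (n : nat)
    (X : R -> R -> Omega -> ndrc_borel R)
    (Y : int -> int -> Omega -> ndrc_borel R)
    (x_gt0 : 0 < x) (T_gt0 : 0 < T)
    (flowX : stochastic_flow P X)
    (flowY : discrete_stochastic_flow P Y)
    (limX : \forall w \ae P, X 0 T w y @[y --> +oo] --> +oo)
    (limY : \forall w \ae P, Y 0 n%:Z w y @[y --> +oo] --> +oo)
    (noatomX : forall y : R, 0 < y -> P [set w | X 0 T w y = x] = 0%E)
    (noatomY : forall y : R, 0 < y -> P [set w | Y 0 n%:Z w y = x] = 0%E)
    (f : R -> R)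
    (diff_f : differentiable_nneg f)
    (supp_f : compact_support_nneg f)
    (f0 : f 0 = 0)
    (* the right-hand side is well defined as a Lebesgue integral *)
    (int_rhs : (@lebesgue_measure R).-integrable `[0, +oo[
       (fun y : R => (derive1 f y)%:E *
          (P [set w | (x < Y 0 n%:Z w y)%R] - P [set w | (x < X 0 T w y)%R]))%E) :
  ('E_P[fun w => f (fine (dual X 0%R T w x))]
     - 'E_P[fun w => f (fine (dual Y 0%R n%:Z w x))]
   = \int[lebesgue_measure]_(y in `[0%R, +oo[)
       ((derive1 f y)%:E *
          (P [set w | (x < Y 0 n%:Z w y)%R] - P [set w | (x < X 0 T w y)%R])))%E.
Proof.
have [M M0 fM] := compact_support_nneg_bounded supp_f.
have [df _] := diff_f.
pose ft (y : R) : R := f (Num.max y 0).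
have cft : continuous ft by exact: continuous_max0.
have ftE y : 0 <= y -> ft y = f y by move=> y0; rewrite /ft max_l.
have [C ftC] : exists C, forall y, `|ft y| <= C.
  have cnft : {within `[0, M], continuous (fun y => `|ft y|)}.
    by apply: continuous_subspaceT => y; apply: cvg_norm; exact: cft.
  have [c _ fc] := EVT_max (ltW M0) cnft.
  exists `|ft c| => y; have [y0|y0] := leP y 0.
    have -> : ft y = ft 0 by rewrite /ft max_r// maxxx.
    by apply: fc; rewrite in_itv/= lexx ltW.
  have [yM|My] := leP y M; first by apply: fc; rewrite in_itv/= yM ltW.
  by rewrite ftE ?fM ?normr0// ltW.
(* The time [- 0] is kept unsimplified so that [tX w] is convertible to [dual X 0 T w x]; likewise
   for [tY]. *)
pose tX w := first_exceedance x (X (- T) (- 0) w).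
pose tY w := first_exceedance x (Y (- n%:Z) (- 0) w).
have mXT : measurable_fun setT (X (- T) (- 0)).
  by apply: (flow_measurable flowX); rewrite oppr0 oppr_le0 ltW.
have mYn : measurable_fun setT (Y (- n%:Z) (- 0)).
  by apply: (dflow_measurable flowY); rewrite oppr0 oppr_le0.
have mtX : measurable_fun setT tX.
  by apply: measurableT_comp mXT; apply: measurable_first_exceedance; exact: ltW.
have mtY : measurable_fun setT tY.
  by apply: measurableT_comp mYn; apply: measurable_first_exceedance; exact: ltW.
have tX0 w : (0 <= tX w)%E by exact: first_exceedance_ge0.
have tY0 w : (0 <= tY w)%E by exact: first_exceedance_ge0.
have lawX y : 0 < y -> P [set w | (tX w <= y%:E)%E] = P [set w | x < X 0 T w y].
  move=> y0; apply: (first_exceedance_law (ltW x_gt0) (ltW y0) mXT _ _ (noatomX y y0)).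
    by apply: (flow_measurable flowX); exact: ltW.
  (* A shift by [T] brings the reversed time interval [[- T, 0]] back to [[0, T]]. *)
  have := flow_stationary flowX (s := - T) (t := - 0) (h := T).
  by rewrite addNr oppr0 add0r; apply; rewrite ?oppr_le0 ?ltW.
have lawY y : 0 < y -> P [set w | (tY w <= y%:E)%E] = P [set w | x < Y 0 n%:Z w y].
  move=> y0; apply: (first_exceedance_law (ltW x_gt0) (ltW y0) mYn _ _ (noatomY y y0)).
    by apply: (dflow_measurable flowY).
  have := dflow_stationary flowY (k := - n%:Z) (l := - 0) n.
  by rewrite addNr oppr0 add0r; apply; rewrite oppr_le0.
(* The bound [fM] needs [M < y] strictly, whereas [f] has to vanish on a closed half-line starting
   at [b]. *)
pose b := M + 1.
have b0 : 0 < b by rewrite addr_gt0.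
have ftb y : b <= y -> ft y = 0.
  move=> b_y; have My : M < y by rewrite (lt_le_trans _ b_y)// ltrDl.
  by rewrite ftE ?fM// (le_trans (ltW M0))// ltW.
have ft0 : ft 0 = 0 by rewrite ftE.
have -> : (fun w => f (fine (dual X 0 T w x))) = (fun w => ft (fine (tX w))).
  by apply/funext => w; rewrite ftE//; exact: fine_ge0.
have -> : (fun w => f (fine (dual Y 0 n%:Z w x))) = (fun w => ft (fine (tY w))).
  by apply/funext => w; rewrite ftE//; exact: fine_ge0.
rewrite (expectation_truncated_exp P mtX cft ftC ft0 ftb).
rewrite (expectation_truncated_exp P mtY cft ftC ft0 ftb).
pose Phi y := truncated_exp P tY ft y - truncated_exp P tX ft y.
pose g y := derive1 f y * (distr_fun P tY y - distr_fun P tX y).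
set h := (fun y : R => _) in int_rhs *.
have hg y : 0 < y -> h y = (g y)%:E.
  move=> y0; rewrite /h -lawX// -lawY// /g /distr_fun EFinM EFinB.
  by rewrite !fineK ?fin_num_measure// -[X in measurable X]setTI;
    exact: emeasurable_fun_infty_c.
have ig : lebesgue_measure.-integrable `]0, b[ (EFin \o g).
  have := @eq_integrable _ _ R lebesgue_measure `]0, b[%classic
    (measurable_itv _) h (EFin \o g).
  apply=> //.
    by move=> y; rewrite inE/= in_itv/= => /andP[y0 _]; rewrite hg.
  apply: integrableS int_rhs => //.
  by move=> y /=; rewrite !in_itv/= => /andP[/ltW -> _].
have hM y : M < y -> h y = 0%E.
  move=> My; rewrite /h (_ : derive1 f y = 0) ?mul0e//.
  rewrite derive1E (near_eq_derive (g := cst 0)) ?derive_cst//.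
  by near=> z; apply: fM; near: z; exact: lt_nbhsr.
(* The integrands [h] and [g] are identified only for [y > 0], so the null point 0 is removed; from
   [b] on, [h] vanishes. *)
transitivity (\int[lebesgue_measure]_(y in `]0%R, b[) (g y)%:E)%E; last first.
  rewrite -(integral_itv_obnd_cbnd (r := 0)); last first.
    apply: measurable_funS (measurable_int _ int_rhs) => //.
    by move=> y /=; rewrite !in_itv/= => /andP[/ltW ->].
  rewrite [LHS]integral_mkcond [RHS]integral_mkcond; apply: eq_integral => y _.
  rewrite !patchE !mem_setE !in_itv/= andbT.
  case: ltP => //= y0; rewrite -/(h y) hg//; case: ltP => // b_y.
  by rewrite -hg// hM// (lt_le_trans _ b_y)// ltrDl.
have cPhi : {within `[0, b], continuous Phi}.
  apply: continuous_subspaceT => y; apply: cvgB.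
    exact: (continuous_truncated_exp mtY cft ftC).
  exact: (continuous_truncated_exp mtX cft ftC).
rewrite (integral_right_derivative b0 cPhi ig).
  by rewrite /Phi !truncated_exp0// subrr subr0 -EFinB opprK addrC.
(* It remains to find the right derivative of [Phi], with half of the error given to each of its two
   terms. *)
move=> y; rewrite in_itv/= => /andP[y0 yb] e e0.
have e20 : 0 < e / 2 by rewrite divr_gt0.
have dft e' : 0 < e' -> \forall z \near y^'+,
    `|ft z - ft y - derive1 f y * (z - y)| <= e' * (z - y).
  move=> e'0; near=> z; have yz : y < z by [].
  rewrite (ftE y (ltW y0)) (ftE z (ltW (lt_trans y0 yz))).
  by near: z; apply: derivable_right_increment => //; exact: df.
near=> z.
have Y1 : `|truncated_exp P tY ft z - truncated_exp P tY ft y -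
    derive1 f y * distr_fun P tY y * (z - y)| <= e / 2 * (z - y).
  by near: z; exact: (truncated_exp_rderiv P mtY cft ftC dft).
have X1 : `|truncated_exp P tX ft z - truncated_exp P tX ft y -
    derive1 f y * distr_fun P tX y * (z - y)| <= e / 2 * (z - y).
  by near: z; exact: (truncated_exp_rderiv P mtX cft ftC dft).
have -> : e * (z - y) = e / 2 * (z - y) + e / 2 * (z - y) by field.
apply: le_trans (lerD Y1 X1); apply: le_trans (ler_normB _ _).
by rewrite /Phi /g le_eqVlt; apply/orP; left; apply/eqP; congr `|_|; ring.
Unshelve. all: end_near. Qed.
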